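(* Let $O_{A_{\mathbb{N}}}$ be the universal $C^*$-algebra generated by a countable family of partial isometries $\{s_i:i=0,1,2,\ldots\}$ satisfying $s_i^*s_j=0$ for all $i\neq j$ and $s_i^*s_i=\sum_{k=0}^i s_ks_k^*$ for all $i=0,1,2,\ldots$. Then $O_{A_{\mathbb{N}}}$ is a type-I $C^*$-algebra. *)

(* Defs.v *)
From HB Require Import structures.
From mathcomp Require Import all_boot all_order all_algebra.
From mathcomp Require Import all_classical all_reals all_analysis.
From mathcomp Require Import complex.

Set Implicit Arguments.
Unset Strict Implicit.
Unset Printing Implicit Defensive.

Import Order.TTheory GRing.Theory Num.Theory.
Import numFieldNormedType.Exports.

Local Open Scope classical_set_scope.
Local Open Scope ring_scope.

(* C*-algebras over the complex numbers R[i].  They are not required to be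
   unital, which is why the ring structures of MathComp are not used.  The norm
   of a completeNormedModType R[i] takes its values in R[i]; they are
   automatically nonnegative reals. *)
HB.mixin Record isCStarAlgebra (R : realType) (A : Type)
    of CompleteNormedModule R[i] A := {
  cmul : A -> A -> A ;
  cstar : A -> A ;
  cmulA : forall a b c, cmul a (cmul b c) = cmul (cmul a b) c ;
  cmul_linearl : forall b, linear (fun a => cmul a b) ;
  cmul_linearr : forall a, linear (cmul a) ;
  cstarK : forall a, cstar (cstar a) = a ;
  cstarM : forall a b, cstar (cmul a b) = cmul (cstar b) (cstar a) ;
  cstarD : forall a b, cstar (a + b) = cstar a + cstar b ;
  cstarZ : forall (k : R[i]) a, cstar (k *: a) = Num.conj k *: cstar a ;
  cnormM : forall a b, `|cmul a b| <= `|a| * `|b| ;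
  cnorm_star : forall a, `|cmul (cstar a) a| = `|a| ^+ 2
}.

#[short(type="cstarType")]
HB.structure Definition CStarAlgebra (R : realType) :=
  {A of isCStarAlgebra R A & CompleteNormedModule R[i] A}.

Declare Scope cstar_scope.
Delimit Scope cstar_scope with cstar.
Notation "a ** b" := (cmul a b) (at level 40, left associativity) : cstar_scope.
Notation "a ^star" := (cstar a) (at level 2, format "a ^star") : cstar_scope.
Local Open Scope cstar_scope.

(* As for every {dot _ for _}, the inner product is linear in its first
   argument and conjugate-linear in its second one. *)
HB.mixin Record isHilbert (R : realType) (H : Type)
    of CompleteNormedModule R[i] H := {
  hdot : {dot H for @Num.conj R[i]} ;
  hdot_norm : forall x : H, hdot x x = `|x| ^+ 2
}.

#[short(type="hilbertType")]
HB.structure Definition Hilbert (R : realType) :=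
  {H of isHilbert R H & CompleteNormedModule R[i] H}.

Section CStar.
Variable R : realType.
Implicit Types A B : cstarType R.

Record star_morphism A B (f : A -> B) : Prop := StarMorphism {
  star_morphism_linear : linear f ;
  star_morphismM : forall a b, f (a ** b) = f a ** f b ;
  star_morphism_star : forall a, f (a^star) = (f a)^star
}.

Definition linear_subspace (V : lmodType R[i]) (S : set V) : Prop :=
  S 0 /\ forall (k : R[i]) u v, S u -> S v -> S (k *: u + v).

Definition cstar_subalgebra A (S : set A) : Prop :=
  [/\ linear_subspace S, closed S,
      forall a b, S a -> S b -> S (a ** b) & forall a, S a -> S (a^star)].

Definition generates A (G : set A) : Prop :=
  smallest (@cstar_subalgebra A) G = setT.

(* Uniqueness of the morphism f below follows from generation by the s i. *)
Definition universal_cstar (rel : forall B, (nat -> B) -> Prop)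
    A (s : nat -> A) : Prop :=
  [/\ rel A s, generates (range s) &
      forall B (t : nat -> B), rel B t ->
        exists f : A -> B, star_morphism f /\ forall i, f (s i) = t i].

Definition partial_isometry A (a : A) : Prop := a ** a^star ** a = a.

Definition OAN_relations A (s : nat -> A) : Prop :=
  [/\ forall i, partial_isometry (s i),
      forall i j, i <> j -> (s i)^star ** s j = 0 &
      forall i, (s i)^star ** s i = \sum_(k < i.+1) s k ** (s k)^star].

End CStar.

Section VonNeumann.
Variables (R : realType) (H : hilbertType R).

Definition bounded_operators : set (H -> H) :=
  [set T | linear T /\ continuous T].

Definition commutant (M : set (H -> H)) : set (H -> H) :=
  [set T | bounded_operators T /\ forall U, M U -> T \o U = U \o T].

Definition orthogonal_projection (p : H -> H) : Prop :=
  [/\ bounded_operators p, p \o p = p & forall x y, hdot (p x) y = hdot x (p y)].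

Definition abelian_projection (M : set (H -> H)) (e : H -> H) : Prop :=
  [/\ M e, orthogonal_projection e &
      forall S T, M S -> M T ->
        (e \o S \o e) \o (e \o T \o e) = (e \o T \o e) \o (e \o S \o e)].

Definition central_projection (M : set (H -> H)) (z : H -> H) : Prop :=
  [/\ M z, orthogonal_projection z & commutant M z].

(* A von Neumann algebra is of type I when every nonzero central projection z
   dominates a nonzero abelian projection e; e <= z is stated as z \o e = e. *)
Definition type_I_von_neumann (M : set (H -> H)) : Prop :=
  forall z, central_projection M z -> z <> cst 0 ->
    exists e, [/\ abelian_projection M e, e <> cst 0 & z \o e = e].

End VonNeumann.

Section TypeI.
Variables (R : realType) (A : cstarType R).

Record representation (H : hilbertType R) (pi : A -> H -> H) : Prop :=
  Representation {
    repr_bounded : forall a, bounded_operators (pi a) ;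
    repr_linear : forall x, linear (fun a => pi a x) ;
    reprM : forall a b, pi (a ** b) = pi a \o pi b ;
    repr_star : forall a x y, hdot (pi a x) y = hdot x (pi (a^star) y)
  }.

Definition nondegenerate_rep (H : hilbertType R) (pi : A -> H -> H) : Prop :=
  smallest [set V : set H | linear_subspace V /\ closed V]
           [set y | exists a x, y = pi a x] = setT.

Definition type_I_cstar : Prop :=
  forall (H : hilbertType R) (pi : A -> H -> H),
    representation pi -> nondegenerate_rep pi ->
    type_I_von_neumann (commutant (commutant (range pi))).

End TypeI.

(* Main.v *)
Require Import Defs.
From mathcomp Require Import all_boot all_order all_algebra.
From mathcomp Require Import all_classical all_reals all_analysis.
From mathcomp Require Import complex ring lra.
Set Implicit Arguments.
Unset Strict Implicit.
Unset Printing Implicit Defensive.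
Import Order.TTheory GRing.Theory Num.Theory.
Import numFieldNormedType.Exports.
Local Open Scope classical_set_scope.
Local Open Scope ring_scope.
Local Open Scope cstar_scope.

(** Write p_i = s_i s_i^* and q_i = s_i^* s_i = p_0 + ... + p_i.  A product
    s_i s_j vanishes unless j <= i, so the nonzero words in the s_i have
    nonincreasing indices and an infinite word is eventually constant; this is
    what forces type I.

    Let M be the bicommutant of a nondegenerate representation pi and z a
    nonzero central projection of M.  If z p_i = 0 for all i, then z kills all
    the generators, hence pi(A), hence everything
    ([nondegenerate_generators]).  So there is a least k with z p_k <> 0, and
    e = z p_k is the required abelian projection.  Indeed z p_j = 0 for j < k
    gives z q_k = e, hence e s_k = s_k e, while e s_i = 0 for i <> k: on the
    range of e the operator s_k restricts to a unitary U, and e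
    annihilates the ranges of the other generators.

    The algebra e pi(A) e is generated by U.  In place of the normal form
    s_mu s_nu^* for the elements of A, the proof uses a property of operators
    T, namely that e s_nu^* T commutes with a given S for every word nu; if S
    commutes with e, U and U^*, then the property is stable under left
    multiplication by pi(A) ([word_commute_repr]) and e has it, so that S
    commutes with e pi(A) e.  Taking S = U and S = U^*, and after that S in
    e pi(A) e, one finds that e pi(A) e is abelian
    ([corner_abelian_repr]).

    Passing from pi(A) to M needs von Neumann's density theorem for two
    vectors ([bicommutant_approx]), which rests on the orthogonal projection
    theorem ([projection_theorem]) in H x H.  Passing from the *-algebra
    generated by the s_i to its closure A needs the continuity of pi, which is
    automatic: for |b| < 1 the operator 1 - b^* b is the square (1 - c)^2 of a
    selfadjoint element, so that 1 - pi(b)^* pi(b) is positive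
    ([selfadjoint_sqrt], [repr_contractive]). *)

(** * The norm as a real number *)

Section RealNorm.
Context {R : realType}.
Local Notation C := R[i].

(** The norm takes its values in the partially ordered field R[i]; its real
    part carries the same information and lives in a total order. *)
Definition nrm {V : normedModType C} (x : V) : R := complex.Re `|x|.

Lemma real_complex_lt (a b : R) : (a%:C%C < b%:C%C) = (a < b).
Proof. by rewrite ltcE /= eqxx. Qed.

Lemma real_complex_le (a b : R) : (a%:C%C <= b%:C%C) = (a <= b).
Proof. by rewrite lecE /= eqxx. Qed.

Lemma normE {V : normedModType C} (x : V) : `|x| = (nrm x)%:C%C.
Proof. by rewrite /nrm RRe_real // ger0_real. Qed.

Lemma gt0_complexP (e : C) : 0 < e -> exists2 d : R, 0 < d & e = d%:C%C.
Proof.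
move=> e0; exists (complex.Re e).
  by move: e0; rewrite ltcE /= => /andP[].
by rewrite RRe_real // gtr0_real.
Qed.

Context {V : normedModType C}.
Implicit Types x y : V.

Lemma nrm_ge0 x : 0 <= nrm x.
Proof. by rewrite -real_complex_le -normE normr_ge0. Qed.

Lemma nrmD x y : nrm (x + y) <= nrm x + nrm y.
Proof. by rewrite -real_complex_le rmorphD /= -!normE ler_normD. Qed.

Lemma nrmN x : nrm (- x) = nrm x.
Proof. by rewrite /nrm normrN. Qed.

Lemma nrmBC x y : nrm (x - y) = nrm (y - x).
Proof. by rewrite /nrm distrC. Qed.

Lemma nrm0 : nrm (0 : V) = 0.
Proof. by rewrite /nrm normr0. Qed.

Lemma nrm_eq0 x : nrm x = 0 -> x = 0.
Proof. by move=> x0; apply/eqP; rewrite -normr_eq0 normE x0. Qed.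

Lemma nrmZ (k : C) x : nrm (k *: x) = complex.Re `|k| * nrm x.
Proof.
by rewrite /nrm normrZ -(RRe_real (ger0_real (normr_ge0 k))) normE -rmorphM.
Qed.

Lemma nrmZr (k : R) x : 0 <= k -> nrm (k%:C%C *: x) = k * nrm x.
Proof.
by move=> k0; rewrite nrmZ ger0_norm // -[0]/(0%:C%C) real_complex_le.
Qed.

Lemma nrm_ball x y (e : R) : ball x (e%:C%C) y = (nrm (x - y) < e) :> Prop.
Proof. by rewrite -ball_normE /= normE real_complex_lt. Qed.

Lemma closed_nrmP (S : set V) :
  closed S <-> forall x,
    (forall e : R, 0 < e -> exists2 y, S y & nrm (x - y) < e) -> S x.
Proof.
split=> [cS x xS|H x xS].
  apply: cS => B /nbhs_ballP[e /= /gt0_complexP[d d0 ->] eB].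
  have [y Sy xy] := xS _ d0; exists y; split => //; apply: eB.
  by rewrite nrm_ball.
apply: H => e e0.
have [|y [Sy]] := xS (ball x (e%:C%C)).
  by apply: nbhsx_ballx; rewrite -[0]/(0%:C%C) real_complex_lt.
by rewrite nrm_ball; exists y.
Qed.

End RealNorm.

Lemma linear_continuousP (R : realType) (V W : normedModType R[i])
    (f : V -> W) : linear f ->
  continuous f <-> exists2 c : R, 0 <= c & forall x, nrm (f x) <= c * nrm x.
Proof.
move=> lf.
have fB x y : f (x - y) = f x - f y by rewrite -scaleN1r addrC lf scaleN1r addrC.
have f0 : f 0 = 0 by rewrite -(subrr 0) fB subrr.
have fZ k x : f (k *: x) = k *: f x by rewrite -[_ *: x]addr0 lf f0 addr0.
split=> [cf|[c c0 fc] x].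
  have /cvgrPdist_lt/(_ 1%:C%C) : f x @[x --> 0] --> f 0 by exact: cf.
  rewrite -[0]/(0%:C%C) real_complex_lt => /(_ ltr01) /nbhs_ballP[e /=].
  move=> /gt0_complexP[d d0 ->] H.
  exists (2 / d); first by rewrite divr_ge0 // ltW.
  move=> x; have [x0|x0] := eqVneq (nrm x) 0.
    by rewrite (nrm_eq0 x0) f0 !nrm0 mulr0.
  have nx : 0 < nrm x by rewrite lt_def x0 nrm_ge0.
  pose k := d / 2 / nrm x.
  have k0 : 0 < k by rewrite !divr_gt0.
  have := H (k%:C%C *: x); rewrite nrm_ball sub0r nrmN nrmZr ?(ltW k0) //.
  rewrite /= f0 sub0r normrN normE real_complex_lt fZ nrmZr ?(ltW k0) //.
  have -> : k * nrm x = d / 2 by rewrite /k mulfVK.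
  rewrite gtr_pMr // invf_lt1 // ltr1n => /(_ isT) H1.
  rewrite -(ler_pM2l k0); apply: (le_trans (ltW H1)).
  have -> // : k * (2 / d * nrm x) = 1.
  by rewrite /k; field; rewrite x0 lt0r_neq0.
apply/cvgrPdist_lt => _ /gt0_complexP[e e0 ->].
have c1 : 0 < c + 1 by rewrite ltr_wpDl.
near=> y; rewrite -fB normE real_complex_lt.
apply: (le_lt_trans (fc _)).
apply: (@le_lt_trans _ _ ((c + 1) * nrm (x - y))).
  by rewrite ler_wpM2r ?nrm_ge0 // lerDl.
rewrite -ltr_pdivlMl // mulrC -real_complex_lt -normE.
near: y; apply: cvgr_dist_lt => //.
by rewrite -[0]/(0%:C%C) real_complex_lt divr_gt0.
Unshelve. all: end_near. Qed.

Lemma cauchy_nrm (R : realType) (V : completeNormedModType R[i]) (u : nat -> V) :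
  (forall e : R, 0 < e -> exists N, forall m n, (N <= m)%N -> (N <= n)%N ->
     nrm (u m - u n) < e) ->
  exists l, forall e : R, 0 < e -> exists N, forall n, (N <= n)%N ->
    nrm (u n - l) < e.
Proof.
move=> H; have : cauchy (u @ \oo).
  apply/cauchyP => _ /gt0_complexP[e e0 ->].
  have [N HN] := H _ e0; exists (u N); exists N => // n /= Nn.
  by rewrite nrm_ball; apply: HN.
move=> /cauchy_cvg ul; exists (lim (u @ \oo)) => e e0.
have /cvgrPdist_lt/(_ e%:C%C) : u @ \oo --> lim (u @ \oo) by [].
rewrite -[0]/(0%:C%C) real_complex_lt => /(_ e0)[N _ HN]; exists N => n Nn.
by have := HN n Nn; rewrite /= normE real_complex_lt nrmBC.
Qed.

(** * Linear maps and C*-algebras *)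

Section LinearFunctions.
Variables (K : pzRingType) (U V : lmodType K) (f : U -> V).
Hypothesis fL : linear f.

Lemma linear_fun0 : f 0 = 0.
Proof. by have := fL (-1) 0 0; rewrite !scaleN1r addr0 oppr0 addNr. Qed.

Lemma linear_funD x y : f (x + y) = f x + f y.
Proof. by rewrite -[x in LHS]scale1r fL scale1r. Qed.

Lemma linear_funZ k x : f (k *: x) = k *: f x.
Proof. by rewrite -[k *: x]addr0 fL linear_fun0 addr0. Qed.

Lemma linear_funB x y : f (x - y) = f x - f y.
Proof. by rewrite linear_funD -[- y]scaleN1r linear_funZ scaleN1r. Qed.

Lemma linear_fun_sum I (r : seq I) (P : pred I) (F : I -> U) :
  f (\sum_(i <- r | P i) F i) = \sum_(i <- r | P i) f (F i).
Proof. exact: (big_morph f linear_funD linear_fun0). Qed.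

End LinearFunctions.

Lemma linear_compose (K : pzRingType) (U V W : lmodType K)
    (f : V -> W) (g : U -> V) : linear f -> linear g -> linear (f \o g).
Proof. by move=> fL gL k x y; rewrite /= gL fL. Qed.

(** Limits of sequences are compared through this criterion: a vector vanishes
    as soon as its norm is bounded by a fixed multiple of every small e. *)
Lemma nrm_small (R : realType) (V : normedModType R[i]) (x : V) (c : R) :
  (forall e, 0 < e -> e <= 1 -> nrm x <= c * e) -> x = 0.
Proof.
move=> H; apply: nrm_eq0; apply: le_anti; rewrite nrm_ge0 andbT.
rewrite leNgt; apply/negP => x0.
have c0 : 0 < c by have := H 1 ltr01 (lexx _); rewrite mulr1; apply: lt_le_trans.
pose e := Num.min 1 (nrm x / (2 * c)).
have e0 : 0 < e by rewrite lt_min ltr01 divr_gt0 // mulr_gt0.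
have : e <= 1 by rewrite ge_min lexx.
move=> /(H _ e0); rewrite leNgt => /negP; apply.
apply: (@le_lt_trans _ _ (c * (nrm x / (2 * c)))).
  by rewrite ler_pM2l // ge_min lexx orbT.
have -> : c * (nrm x / (2 * c)) = nrm x / 2 by field; rewrite lt0r_neq0.
by rewrite ltr_pdivrMr // ltr_pMr // ltr1n.
Qed.

Section CStarNorm.
Variables (R : realType) (A : cstarType R).
Implicit Types a b c : A.

Lemma nrm_cmul a b : nrm (a ** b) <= nrm a * nrm b.
Proof. by have := cnormM a b; rewrite !normE -rmorphM real_complex_le. Qed.

Lemma nrm_starM a : nrm (a^star ** a) = nrm a ^+ 2.
Proof. by apply: complexI; have := cnorm_star a; rewrite !normE rmorphXn. Qed.

(** From |b|^2 = |b^* b| <= |b^*| |b|, applied to a and to a^*. *)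
Lemma nrm_star a : nrm (a^star) = nrm a.
Proof.
suff le b : nrm b <= nrm (b^star).
  by apply: le_anti; rewrite le andbT -[X in _ <= nrm X]cstarK le.
have [b0|b0] := eqVneq (nrm b) 0; first by rewrite b0 nrm_ge0.
have b_gt0 : 0 < nrm b by rewrite lt_def b0 nrm_ge0.
by rewrite -(ler_pM2r b_gt0) -expr2 -nrm_starM nrm_cmul.
Qed.

Lemma cmulBl a b c : (a - b) ** c = a ** c - b ** c.
Proof. exact: (linear_funB (cmul_linearl c)). Qed.

Lemma cmulBr a b c : a ** (b - c) = a ** b - a ** c.
Proof. exact: (linear_funB (cmul_linearr a)). Qed.

Lemma cmul0l a : 0 ** a = 0.
Proof. exact: (linear_fun0 (cmul_linearl a)). Qed.

Lemma cmul0r a : a ** 0 = 0.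
Proof. exact: (linear_fun0 (cmul_linearr a)). Qed.

Lemma cstar0 : (0 : A)^star = 0.
Proof. by apply: (addIr (0 : A)^star); rewrite -cstarD addr0 add0r. Qed.

Lemma cstarB a b : (a - b)^star = a^star - b^star.
Proof. by rewrite cstarD -scaleN1r cstarZ rmorphN rmorph1 scaleN1r. Qed.

Lemma nrm_sqrB a b : nrm (a ** a - b ** b) <= (nrm a + nrm b) * nrm (a - b).
Proof.
have -> : a ** a - b ** b = a ** (a - b) + (a - b) ** b.
  by rewrite cmulBr cmulBl addrA subrK.
apply: (le_trans (nrmD _ _)); rewrite mulrDl lerD ?nrm_cmul //.
by rewrite [leRHS]mulrC nrm_cmul.
Qed.

(** The element c plays the part of 1 - (1 - a)^(1/2), which makes sense
    although A need not have a unit.  It is the limit of the iterates of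
    the contraction c |-> (a + c^2) / 2 of the ball of radius |a|. *)
Lemma selfadjoint_sqrt a : a^star = a -> nrm a < 1 ->
  exists c, c^star = c /\ c + c = a + c ** c.
Proof.
move=> aS a1; pose r := nrm a; have r0 : 0 <= r := nrm_ge0 a.
have half : 0 <= 2^-1 :> R by rewrite invr_ge0.
pose f c := (2^-1 : R)%:C%C *: (a + c ** c).
pose u n := iter n f 0.
have uS n : (u n)^star = u n.
  elim: n => [|n IH] /=; first exact: cstar0.
  rewrite /f cstarZ cstarD cstarM -/(u n) IH aS conj_Creal // ger0_real //.
  by rewrite -[0]/(0%:C%C) real_complex_le.
have ur n : nrm (u n) <= r.
  elim: n => [|n IH] /=; first by rewrite nrm0.
  rewrite nrmZr // mulrC ler_pdivrMr // -/(u n).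
  apply: (le_trans (nrmD _ _)); rewrite -/r mulr_natr mulr2n lerD2l.
  apply: (le_trans (nrm_cmul _ _)).
  apply: (le_trans (ler_pM (nrm_ge0 _) (nrm_ge0 _) IH IH)).
  by rewrite ler_piMr // ltW.
have f_contr m n : nrm (f (u m) - f (u n)) <= r * nrm (u m - u n).
  rewrite /f -scalerBr opprD addrACA subrr add0r nrmZr //.
  rewrite mulrC ler_pdivrMr //; apply: (le_trans (nrm_sqrB _ _)).
  rewrite mulrAC ler_wpM2r ?nrm_ge0 // mulr_natr mulr2n lerD //.
have u_geo n j : nrm (u (n + j)%N - u n) <= r ^+ n.
  elim: n => [|n IH]; first by rewrite subr0 (le_trans (ur _)) // ltW.
  by rewrite exprS (le_trans (f_contr _ _)) // ler_wpM2l.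
have r_small e : 0 < e -> exists N, r ^+ N < e.
  move=> e0; have r1 : `|r| < 1 by rewrite ger0_norm.
  have /cvgrPdist_lt/(_ _ e0)[N _ /(_ N (leqnn N))] := cvg_expr r1.
  by rewrite /= sub0r normrN ger0_norm ?exprn_ge0 //; exists N.
have [|l ul] := @cauchy_nrm _ _ u.
  move=> e e0; have [N HN] := r_small (e / 2) (divr_gt0 e0 (ltr0Sn _ _)).
  exists N => m n Nm Nn; rewrite -(subrKA (u N)).
  apply: (le_lt_trans (nrmD _ _)); rewrite -(subnKC Nm) -(subnKC Nn).
  rewrite [X in _ + X]nrmBC [ltRHS]splitr.
  by apply: ltrD; apply: (le_lt_trans (u_geo _ _)).
exists l; split; apply/eqP; rewrite -subr_eq0; apply/eqP.
  apply: (@nrm_small _ _ _ 2) => e e0 _; have [N /(_ N (leqnn N)) HN] := ul _ e0.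
  have -> : l^star - l = (l - u N)^star + (u N - l).
    by rewrite cstarB uS addrA subrK.
  by apply: (le_trans (nrmD _ _)); rewrite nrm_star nrmBC; move: HN; lra.
apply: (@nrm_small _ _ _ 5) => e e0 e1; have [N HN] := ul _ e0.
have /ltW uN := HN N (leqnn N); have /ltW uN1 := HN N.+1 (leqnSn N).
have uE : u N.+1 + u N.+1 = a + u N ** u N.
  rewrite /= -/(u N) /f -scalerDl -rmorphD.
  by have -> : 2^-1 + 2^-1 = 1 :> R; [field|rewrite scale1r].
have -> : l + l - (a + l ** l) =
    (l - u N.+1) + (l - u N.+1) + (u N ** u N - l ** l).
  by rewrite (addrACA l) -opprD uE !opprD !addrA subrK.
have lr : nrm l <= 2.
  rewrite -[l](subrK (u N)) (le_trans (nrmD _ _)) // nrmBC.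
  by move: (ur N) (ltW a1) e1 uN; rewrite -/r; lra.
have sqr := nrm_sqrB (u N) l.
have D1 := nrmD (l - u N.+1 + (l - u N.+1)) (u N ** u N - l ** l).
have D2 := nrmD (l - u N.+1) (l - u N.+1).
apply: (le_trans D1); move: D2 uN1; rewrite [nrm (l - _)]nrmBC => D2 uN1.
have D3 : nrm (u N ** u N - l ** l) <= 3 * e.
  apply: (le_trans sqr); apply: ler_pM => //; rewrite ?addr_ge0 ?nrm_ge0 //.
  by move: (ur N) (ltW a1); rewrite -/r; lra.
by lra.
Qed.

End CStarNorm.

Section Dot.
Variables (R : realType) (H : hilbertType R).
Implicit Types x y z : H.

Lemma dotDl x y z : hdot (x + y) z = hdot x z + hdot y z.
Proof. exact: linearDl. Qed.

Lemma dotZl k x z : hdot (k *: x) z = k * hdot x z.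
Proof. exact: linearZl_LR. Qed.

Lemma dotC x y : hdot x y = Num.conj (hdot y x).
Proof. by rewrite hermC expr0 mul1r. Qed.

Lemma dotDr x y z : hdot z (x + y) = hdot z x + hdot z y.
Proof. exact: linearDr. Qed.

Lemma dotBl x y z : hdot (x - y) z = hdot x z - hdot y z.
Proof. exact: linearBl. Qed.

Lemma dotBr x y z : hdot z (x - y) = hdot z x - hdot z y.
Proof. exact: linearBr. Qed.

Lemma dot_nrm x : hdot x x = (nrm x ^+ 2)%:C%C.
Proof. by rewrite hdot_norm normE -rmorphXn. Qed.

Lemma dot_eq0 x : (forall y, hdot x y = 0) -> x = 0.
Proof.
by move=> /(_ x)/eqP; rewrite hdot_norm sqrf_eq0 normr_eq0 => /eqP.
Qed.

End Dot.

Section Representations.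
Variables (R : realType) (A : cstarType R) (H : hilbertType R).
Variables (pi : A -> H -> H) (rpi : representation pi).

Lemma repr_linear_op a : linear (pi a).
Proof. by have [] := repr_bounded rpi a. Qed.

(** With c as in [selfadjoint_sqrt] for a = b^* b,
    |x|^2 - |pi b x|^2 = |x - pi c x|^2. *)
Lemma repr_contractive_ball b x : nrm b < 1 -> nrm (pi b x) <= nrm x.
Proof.
move=> b1; have [c [cS cE]] : exists c : A,
    c^star = c /\ c + c = b^star ** b + c ** c.
  apply: selfadjoint_sqrt; first by rewrite cstarM cstarK.
  by rewrite nrm_starM expr_lt1 // nrm_ge0.
have piD a1 a2 : pi (a1 + a2) x = pi a1 x + pi a2 x.
  by rewrite (linear_funD (repr_linear rpi x)).
have E : hdot (x - pi c x) (x - pi c x) = hdot x x - hdot (pi b x) (pi b x).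
  have cx : hdot (pi c x) x = hdot x (pi c x) by rewrite (repr_star rpi) cS.
  have cc : hdot (pi c x) (pi c x) = hdot x (pi (c ** c) x).
    by rewrite (repr_star rpi) cS (reprM rpi).
  have bb : hdot (pi b x) (pi b x) = hdot x (pi (b^star ** b) x).
    by rewrite (repr_star rpi) (reprM rpi).
  have -> : hdot (pi b x) (pi b x) =
      hdot x (pi c x) + hdot x (pi c x) - hdot x (pi (c ** c) x).
    by rewrite bb -dotDr -piD cE piD dotDr addrK.
  by rewrite dotBl !dotBr cx cc; ring.
move: E; rewrite !dot_nrm -rmorphB => /complexI E.
have : 0 <= nrm x ^+ 2 - nrm (pi b x) ^+ 2 by rewrite -E sqr_ge0.
by rewrite subr_ge0 ler_sqr // nnegrE nrm_ge0.
Qed.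

(** Rescale a to norm less than 1, with a margin d that tends to 0. *)
Lemma repr_contractive a x : nrm (pi a x) <= nrm a * nrm x.
Proof.
apply/ler_addgt0Pr => e e0.
pose d := e / (nrm x + 1).
have x1 : 0 < nrm x + 1 by rewrite ltr_wpDl // nrm_ge0.
have d0 : 0 < d by rewrite divr_gt0.
have t0 : 0 < nrm a + d by rewrite ltr_wpDl // nrm_ge0.
have ti : 0 < (nrm a + d)^-1 by rewrite invr_gt0.
have := @repr_contractive_ball ((nrm a + d)^-1%:C%C *: a) x.
rewrite (linear_funZ (repr_linear rpi x)) !(nrmZr _ (ltW ti)).
rewrite [_ * nrm a]mulrC ltr_pdivrMr // mul1r ltrDl => /(_ d0).
rewrite mulrC ler_pdivrMr // => /le_trans; apply.
rewrite mulrC mulrDl lerD2l /d mulrAC ler_pdivrMr // ler_pM2l //.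
by rewrite lerDl.
Qed.

End Representations.

(** * Orthogonal projections in a complete inner product space *)

Section SquaredModulus.
Variable R : realType.
Implicit Types c : R[i].

Definition sqmod c : R := complex.Re c ^+ 2 + complex.Im c ^+ 2.

Lemma sqmodE c : (sqmod c)%:C%C = c * Num.conj c.
Proof.
case: c => a b; apply/eqP; rewrite eq_complex /= /sqmod /=.
by apply/andP; split; apply/eqP; ring.
Qed.

Lemma sqmod_ge0 c : 0 <= sqmod c.
Proof. by rewrite /sqmod addr_ge0 ?sqr_ge0. Qed.

Lemma sqmod_conj c : sqmod (Num.conj c) = sqmod c.
Proof. by case: c => a b; rewrite /sqmod /= sqrrN. Qed.

Lemma sqmodD c1 c2 : sqmod (c1 + c2) <= 2 * sqmod c1 + 2 * sqmod c2.
Proof. case: c1 c2 => [a b] [c d]; rewrite /sqmod /=.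
by have := sqr_ge0 (a - c); have := sqr_ge0 (b - d); lra. Qed.

Lemma sqmod_small c (M : R) : (forall e, 0 < e -> sqmod c <= M * e) -> c = 0.
Proof.
move=> H; suff : sqmod c = 0.
  case: c {H} => a b /eqP; rewrite /sqmod /= paddr_eq0 ?sqr_ge0 //.
  by rewrite !sqrf_eq0 => /andP[/eqP -> /eqP ->].
apply: le_anti; rewrite sqmod_ge0 andbT; apply/ler_addgt0Pr => e e0.
have M1 : 0 < `|M| + 1 by rewrite ltr_wpDl.
apply: (le_trans (H _ (divr_gt0 e0 M1))); rewrite add0r mulrCA ger_pMr //.
by rewrite ler_pdivrMr // mul1r (le_trans (ler_norm _)) // lerDl.
Qed.

End SquaredModulus.

Section OrthogonalProjection.
Variables (R : realType) (E : lmodType R[i]) (d : E -> E -> R[i]).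
Hypothesis dD : forall x y z, d (x + y) z = d x z + d y z.
Hypothesis dZ : forall k x z, d (k *: x) z = k * d x z.
Hypothesis dC : forall x y, d x y = Num.conj (d y x).
Hypothesis d_ge0 : forall x, 0 <= d x x.
Hypothesis d_eq0 : forall x, d x x = 0 -> x = 0.

Let q (x : E) : R := complex.Re (d x x).

Hypothesis complete_d : forall u : nat -> E,
  (forall e : R, 0 < e -> exists N, forall m n, (N <= m)%N -> (N <= n)%N ->
     q (u m - u n) < e) ->
  exists l, forall e : R, 0 < e -> exists N, forall n, (N <= n)%N ->
    q (u n - l) < e.

Variable G : set E.
Hypothesis G_sub : linear_subspace G.

(** Closure of G for the norm of d; it is phrased with the form alone because E
    carries no topology. *)
Definition adherent (x : E) : Prop :=
  forall e : R, 0 < e -> exists2 g, G g & q (x - g) < e.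

Definition orthogonal (x : E) : Prop := forall g, G g -> d x g = 0.

Let dE x : d x x = (q x)%:C%C.
Proof. by rewrite RRe_real // ger0_real. Qed.

Let q_ge0 x : 0 <= q x.
Proof. by have := d_ge0 x; rewrite dE -[0]/(0%:C%C) real_complex_le. Qed.

Let dN x y : d (- x) y = - d x y.
Proof. by rewrite -scaleN1r dZ mulN1r. Qed.

Let dB x y z : d (x - y) z = d x z - d y z.
Proof. by rewrite dD dN. Qed.

Let dDr x y z : d z (x + y) = d z x + d z y.
Proof. by rewrite dC dD rmorphD /= -!dC. Qed.

Let dNr x y : d y (- x) = - d y x.
Proof. by rewrite dC dN rmorphN /= -dC. Qed.

Let dBr x y z : d z (x - y) = d z x - d z y.
Proof. by rewrite dC dB rmorphB /= -!dC. Qed.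

Let dZr k x z : d z (k *: x) = Num.conj k * d z x.
Proof. by rewrite dC dZ rmorphM /= -!dC. Qed.

Let qZ k x : q (k *: x) = sqmod k * q x.
Proof. by apply: complexI; rewrite -dE dZ dZr mulrA -sqmodE dE -rmorphM. Qed.

Let qN x : q (- x) = q x.
Proof. by rewrite -scaleN1r qZ /sqmod /= oppr0 expr0n addr0 sqrrN expr1n mul1r. Qed.

Let q_parallelogram x y : q (x + y) + q (x - y) = 2 * q x + 2 * q y.
Proof.
apply: complexI; rewrite 2!rmorphD !rmorphM rmorph_nat /= -!dE dB dD !dDr !dNr.
by ring.
Qed.

Let qD x y : q (x + y) <= 2 * q x + 2 * q y.
Proof. by rewrite -q_parallelogram lerDl. Qed.

(** Subtracting from u a multiple of its component along g shortens it by an explicit amount; the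
    denominator q g + 1 instead of q g avoids the case g = 0. *)
Let shorten u g : exists k,
  q (u - k *: g) <= q u - sqmod (d u g) / (q g + 1).
Proof.
have g1 : 0 < q g + 1 by rewrite ltr_wpDl.
pose s := (q g + 1)^-1; have s0 : 0 < s by rewrite invr_gt0.
exists (s%:C%C * d u g).
have -> : q (u - (s%:C%C * d u g) *: g) =
    q u - 2 * s * sqmod (d u g) + s * s * sqmod (d u g) * q g.
  apply: complexI; rewrite rmorphD rmorphB !rmorphM rmorph_nat /= sqmodE -!dE.
  rewrite dB !dBr !dZ !dZr (dC g u) rmorphM /= (conj_Creal (_ : s%:C%C \is Num.real)).
    by ring.
  by rewrite ger0_real // -[0]/(0%:C%C) real_complex_le ltW.
have : s * q g <= 1 by rewrite mulrC ler_pdivrMr // mul1r lerDl.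
move: (sqmod_ge0 (d u g)) s0; rewrite -/s.
set m := sqmod _ => m0 s0 sg.
have : m * s * (s * q g) <= m * s by rewrite ler_piMr // mulr_ge0 // ltW.
by lra.
Qed.

Let weak_Cauchy_Schwarz u g : sqmod (d u g) <= (q g + 1) * q u.
Proof.
have [k Hk] := shorten u g; have g1 : 0 < q g + 1 by rewrite ltr_wpDl.
by rewrite -ler_pdivrMl // mulrC -subr_ge0 (le_trans _ Hk).
Qed.

Lemma orthogonal_adherent u v : orthogonal u -> adherent v -> d u v = 0.
Proof.
move=> uG vG; apply: (@sqmod_small _ _ (q u + 1)) => e /vG[g Gg ge].
rewrite -[v](subrK g) dDr (uG g Gg) addr0 dC sqmod_conj.
apply: (le_trans (weak_Cauchy_Schwarz _ _)).
by rewrite ler_wpM2l ?addr_ge0 // ltW.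
Qed.

Let adherent_lin k x y : adherent x -> adherent y -> adherent (k *: x + y).
Proof.
move=> xG yG e e0.
have k1 : 0 < sqmod k + 1 by rewrite ltr_wpDl // sqmod_ge0.
have [g Gg xg] := xG (e / 4 / (sqmod k + 1)) (divr_gt0 (divr_gt0 e0 (ltr0Sn _ _)) k1).
have [h Gh yh] := yG (e / 4) (divr_gt0 e0 (ltr0Sn _ _)).
exists (k *: g + h); first exact: G_sub.2.
rewrite opprD addrACA -scalerBr; apply: (le_lt_trans (qD _ _)).
rewrite qZ; move: xg; rewrite ltr_pdivlMr // mulrDr mulr1 => xg.
by move: (q_ge0 (x - g)); lra.
Qed.

(** The usual minimizing sequence: by the parallelogram identity it is a
    Cauchy sequence, and by the shortening inequality w minus its terms
    becomes orthogonal to G in the limit. *)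
Let projection_exists w : exists p, adherent p /\ orthogonal (w - p).
Proof.
pose D := [set q (w - g) | g in G].
have D0 : D !=set0 by exists (q (w - 0)); exists 0 => //; exact: G_sub.1.
have D_inf : has_inf D by split => //; exists 0 => _ [g _ <-].
have infD g : G g -> inf D <= q (w - g).
  by move=> Gg; apply: ge_inf; [case: D_inf|exists g].
have /choice[u uP] n : exists g, G g /\ q (w - g) < inf D + n.+1%:R^-1.
  have n0 : 0 < n.+1%:R^-1 :> R by rewrite invr_gt0.
  by have [_ [g Gg <-] lt] := inf_adherent n0 D_inf; exists g.
have Gu n := (uP n).1; have qu n := (uP n).2.
have small e : 0 < e -> exists N, forall n, (N <= n)%N -> n.+1%:R^-1 < e :> R.
  move=> e0; have /cvgrPdist_lt/(_ _ e0)[N _ HN] := @cvg_harmonic R.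
  exists N => n /HN; rewrite /= sub0r normrN ger0_norm // invr_ge0 //.
have [|p pP] := @complete_d u.
  move=> e e0; have [N HN] := small (e / 4) (divr_gt0 e0 (ltr0Sn _ _)).
  exists N => m n Nm Nn.
  have := q_parallelogram (w - u m) (w - u n).
  have -> : w - u m - (w - u n) = - (u m - u n).
    by rewrite opprB addrC subrKA opprB.
  rewrite qN => par.
  have mid : inf D <= q (w - 2^-1 *: (u m + u n)).
    apply: infD; rewrite -[_ *: _]addr0; apply: G_sub.2; last exact: G_sub.1.
    by rewrite -[u m]scale1r; apply: G_sub.2.
  have E4 : q (w - u m + (w - u n)) = 4 * q (w - 2^-1 *: (u m + u n)).
    have -> : w - u m + (w - u n) = 2 *: (w - 2^-1 *: (u m + u n)).
      rewrite scalerBr scalerA divff ?pnatr_eq0 // scale1r addrACA -opprD.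
      by rewrite scaler_nat mulr2n.
    by rewrite qZ /sqmod /=; ring.
  move: par mid (qu m) (qu n) (HN m Nm) (HN n Nn); rewrite E4.
  by move: (m.+1%:R^-1) (n.+1%:R^-1) => a b; lra.
exists p; split=> [e e0|g Gg].
  have [N /(_ N (leqnn N)) HN] := pP _ e0.
  by exists (u N) => //; rewrite -opprB qN.
apply: (@sqmod_small _ _ (4 * (q g + 1))) => e e0.
have [N1 HN1] := small _ e0; have [N2 HN2] := pP _ e0.
pose n := maxn N1 N2; have n1 := HN1 n (leq_maxl _ _).
have /ltW n2 := HN2 n (leq_maxr _ _).
have -> : d (w - p) g = d (w - u n) g + d (u n - p) g by rewrite -dD subrKA.
apply: (le_trans (sqmodD _ _)).
have g1 : 0 < q g + 1 by rewrite ltr_wpDl.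
have A1 : sqmod (d (w - u n) g) <= (q g + 1) * e.
  have [k Hk] := shorten (w - u n) g.
  rewrite -ler_pdivrMl // mulrC.
  have : inf D <= q (w - u n - k *: g).
    rewrite -addrA -opprD; apply: infD; rewrite addrC; apply: G_sub.2 => //.
  by move: (qu n) n1 Hk; move: (n.+1%:R^-1) => a; lra.
have A2 : sqmod (d (u n - p) g) <= (q g + 1) * e.
  by apply: (le_trans (weak_Cauchy_Schwarz _ _)); rewrite ler_pM2l.
by move: A1 A2; lra.
Qed.

(** Linearity of P comes from the uniqueness in the last clause, and the
    bound from Pythagoras. *)
Lemma projection_theorem : exists P : E -> E,
  [/\ linear P, forall w, adherent (P w) /\ orthogonal (w - P w),
      forall w, q (P w) <= q w &
      forall w p, adherent p -> orthogonal (w - p) -> P w = p].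
Proof.
have /choice[P HP] := projection_exists.
have uniqP w p : adherent p -> orthogonal (w - p) -> P w = p.
  move=> pG wp; apply/eqP; rewrite -subr_eq0; apply/eqP/d_eq0.
  apply: orthogonal_adherent.
    move=> g Gg; rewrite -[P w - p](subrKA w) addrC dD (wp _ Gg) add0r.
    by rewrite -opprB dN (HP w).2 // oppr0.
  by rewrite addrC -scaleN1r; apply: adherent_lin => //; case: (HP w).
exists P; split => //; last first.
- move=> w; have [aP oP] := HP w; have := orthogonal_adherent oP aP => o.
  have : d w w = d (w - P w) (w - P w) + d (P w) (P w).
    have o' : d (P w) (w - P w) = 0 by rewrite dC o rmorph0.
    have dd a b : d (a + b) (a + b) = d a a + d a b + (d b a + d b b).
      by rewrite dD !dDr.
    by rewrite -[in LHS](subrK (P w) w) (dd (w - P w)) o o' addr0 add0r.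
  rewrite !dE -rmorphD => /complexI ->; by rewrite lerDr.
move=> k x y; apply: uniqP; first by apply: adherent_lin; apply: (HP _).1.
move=> g Gg; rewrite opprD addrACA -scalerBr dD dZ.
by rewrite !(HP _).2 // mulr0 addr0.
Qed.

End OrthogonalProjection.

(** * Density in the bicommutant *)

Section PairDot.
Variables (R : realType) (H : hilbertType R).
Implicit Types u v w : (H * H)%type.

(** H x H with this form is the Hilbert sum of two copies of H; the norm of
    the product type is the maximum norm, which comes from no inner product. *)
Definition pair_dot u v : R[i] := hdot u.1 v.1 + hdot u.2 v.2.

Definition pair_nrm2 u : R := complex.Re (pair_dot u u).

Lemma pair_nrm2E u : pair_nrm2 u = nrm u.1 ^+ 2 + nrm u.2 ^+ 2.
Proof. by rewrite /pair_nrm2 /pair_dot !dot_nrm. Qed.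

Lemma pair_dotD u v w : pair_dot (u + v) w = pair_dot u w + pair_dot v w.
Proof. by rewrite /pair_dot !dotDl addrACA. Qed.

Lemma pair_dotZ k u w : pair_dot (k *: u) w = k * pair_dot u w.
Proof. by rewrite /pair_dot !dotZl mulrDr. Qed.

Lemma pair_dotC u v : pair_dot u v = Num.conj (pair_dot v u).
Proof. by rewrite /pair_dot rmorphD /= -!dotC. Qed.

Lemma pair_dot_ge0 u : 0 <= pair_dot u u.
Proof. by rewrite /pair_dot !hdot_norm addr_ge0 // exprn_ge0. Qed.

Lemma pair_dot_eq0 u : pair_dot u u = 0 -> u = 0.
Proof.
move/eqP; rewrite /pair_dot !hdot_norm paddr_eq0 ?exprn_ge0 //.
by rewrite !sqrf_eq0 !normr_eq0; case: u => x y /= /andP[/eqP -> /eqP ->].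
Qed.

Lemma pair_nrm_lt u (e : R) : 0 < e -> pair_nrm2 u < e ^+ 2 ->
  nrm u.1 < e /\ nrm u.2 < e.
Proof.
rewrite pair_nrm2E => e0 ue; have := sqr_ge0 (nrm u.1); have := sqr_ge0 (nrm u.2).
by split; rewrite -ltr_sqr ?nnegrE ?nrm_ge0 ?(ltW e0) //; lra.
Qed.

Lemma pair_complete (u : nat -> H * H) :
  (forall e : R, 0 < e -> exists N, forall m n, (N <= m)%N -> (N <= n)%N ->
     pair_nrm2 (u m - u n) < e) ->
  exists l, forall e : R, 0 < e -> exists N, forall n, (N <= n)%N ->
    pair_nrm2 (u n - l) < e.
Proof.
move=> uC.
have [|x xP] := @cauchy_nrm _ H (fun n => (u n).1).
  move=> e e0; have [N HN] := uC _ (exprn_gt0 2 e0); exists N => m n Nm Nn.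
  by have [] := pair_nrm_lt e0 (HN m n Nm Nn).
have [|y yP] := @cauchy_nrm _ H (fun n => (u n).2).
  move=> e e0; have [N HN] := uC _ (exprn_gt0 2 e0); exists N => m n Nm Nn.
  by have [] := pair_nrm_lt e0 (HN m n Nm Nn).
exists (x, y) => e e0.
(* t <= 1 makes squares below t as well. *)
pose t := Num.min 1 (e / 2).
have t0 : 0 < t by rewrite lt_min ltr01 divr_gt0.
have t1 : t <= 1 by rewrite ge_min lexx.
have te : t <= e / 2 by rewrite ge_min lexx orbT.
have [N1 HN1] := xP _ t0; have [N2 HN2] := yP _ t0.
exists (maxn N1 N2) => n; rewrite geq_max => /andP[/HN1 n1 /HN2 n2].
rewrite pair_nrm2E /=.
have sq (z : H) : nrm z < t -> nrm z ^+ 2 < t.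
  move=> zt; apply: (@le_lt_trans _ _ (nrm z)) => //.
  by rewrite expr2 ler_piMr ?nrm_ge0 // (le_trans (ltW zt)).
by have := sq _ n1; have := sq _ n2; lra.
Qed.

End PairDot.

Lemma bicommutant_bounded (R : realType) (H : hilbertType R)
    (M : set (H -> H)) (T : H -> H) : commutant M T ->
  linear T /\ exists2 c : R, 0 <= c & forall x, nrm (T x) <= c * nrm x.
Proof. by move=> [[TL Tc] _]; split=> //; apply/(linear_continuousP TL). Qed.

Section Density.
Variables (R : realType) (A : cstarType R) (H : hilbertType R).
Variables (pi : A -> H -> H) (rpi : representation pi).

(** This is von Neumann's density theorem for two vectors: the projection
    P onto the closure of {(pi a x, pi a y)} is a 2 x 2 matrix of operators
    that commute with pi(A), hence with T; so (T, T) commutes with P and maps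
    (x, y) into that closure.  The element p puts (x, y) itself into the
    subspace. *)
Lemma bicommutant_approx T (p : A) x y (e : R) :
  commutant (commutant (range pi)) T -> pi p x = x -> pi p y = y -> 0 < e ->
  exists a, nrm (T x - pi a x) < e /\ nrm (T y - pi a y) < e.
Proof.
move=> MT px py e0.
pose L a (u : H * H) : H * H := (pi a u.1, pi a u.2).
pose G : set (H * H) := range (fun a => L a (x, y)).
have G_sub : linear_subspace G.
  split=> [|k _ _ [a _ <-] [b _ <-]].
    by exists 0 => //; rewrite /L /= !(linear_fun0 (repr_linear rpi _)).
  by exists (k *: a + b) => //; rewrite /L /= !(repr_linear rpi).
have L_lin a : linear (L a).
  by move=> k [u1 u2] [v1 v2]; rewrite /L /= !(repr_linear_op rpi).
have [P [P_lin P_pos P_le P_uniq]] := projection_theorem (@pair_dotD _ H)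
  (@pair_dotZ _ H) (@pair_dotC _ H) (@pair_dot_ge0 _ H) (@pair_dot_eq0 _ H)
  (@pair_complete _ H) G_sub.
have P_adh w := (P_pos w).1; have P_orth w := (P_pos w).2.
have G_L a u : G u -> G (L a u).
  by move=> [b _ <-]; exists (a ** b) => //; rewrite /L /= !(reprM rpi).
have L_star a u v : pair_dot (L a u) v = pair_dot u (L (a^star) v).
  by rewrite /pair_dot /= !(repr_star rpi).
have L_le a u : pair_nrm2 (L a u) <= nrm a ^+ 2 * pair_nrm2 u.
  rewrite !pair_nrm2E /= mulrDr -!exprMn.
  by apply: lerD; rewrite ler_sqr ?nnegrE ?mulr_ge0 ?nrm_ge0 ?repr_contractive.
have P_L a w : P (L a w) = L a (P w).
  apply: P_uniq => [d d0|g Gg]; last first.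
    by rewrite -(linear_funB (L_lin a)) L_star P_orth //; exact: G_L.
  have a1 : 0 < nrm a ^+ 2 + 1 by rewrite ltr_wpDl // sqr_ge0.
  have [g Gg gP] := P_adh w _ (divr_gt0 d0 a1); exists (L a g); first exact: G_L.
  rewrite -(linear_funB (L_lin a)); apply: (le_lt_trans (L_le _ _)).
  rewrite ltr_pdivlMr // in gP; apply: le_lt_trans gP.
  by rewrite mulrC ler_wpM2l ?lerDl // -/(pair_nrm2 _) pair_nrm2E addr_ge0 ?sqr_ge0.
have Gxy : G (x, y) by exists p => //; rewrite /L /= px py.
have P_xy : P (x, y) = (x, y).
  apply: P_uniq => [d d0|g _]; last by rewrite subrr /pair_dot !linear0l addr0.
  by exists (x, y) => //; rewrite subrr -/(pair_nrm2 _) pair_nrm2E /= nrm0 expr0n addr0.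
(* An entry of the matrix P is out o P o inj, where inj and out are an
   inclusion and a coordinate; it lies in the commutant of pi(A). *)
have T_entry (inj : H -> H * H) (out : H * H -> H) :
    linear inj -> linear out -> (forall a u, inj (pi a u) = L a (inj u)) ->
    (forall a w, out (L a w) = pi a (out w)) ->
    (forall u, pair_nrm2 (inj u) <= nrm u ^+ 2) ->
    (forall w, nrm (out w) ^+ 2 <= pair_nrm2 w) ->
    forall u, T (out (P (inj u))) = out (P (inj (T u))).
  move=> inj_lin out_lin inj_L out_L inj_le out_le u.
  have Q_lin : linear (fun v => out (P (inj v))).
    by move=> k v w; rewrite inj_lin P_lin out_lin.
  suff /(MT.2 _) TQ : commutant (range pi) (fun v => out (P (inj v))).
    exact: (congr1 (@^~ u) TQ).
  split; last by move=> _ [a _ <-]; apply/funext => v /=; rewrite inj_L P_L out_L.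
  split=> //; apply/(linear_continuousP Q_lin); exists 1 => // v.
  rewrite mul1r -ler_sqr ?nnegrE ?nrm_ge0 //.
  exact: le_trans (out_le _) (le_trans (P_le _) (inj_le _)).
have [T_lin _] := bicommutant_bounded MT.
have T0 := linear_fun0 T_lin.
have T_P : P (T x, T y) = (T x, T y).
  have T_col (inj : H -> H * H) : linear inj ->
      (forall a u, inj (pi a u) = L a (inj u)) ->
      (forall u, pair_nrm2 (inj u) <= nrm u ^+ 2) ->
      forall u, P (inj (T u)) = (T (P (inj u)).1, T (P (inj u)).2).
    move=> inj_lin inj_L inj_le u.
    rewrite (T_entry inj fst) ?(T_entry inj snd) //.
    - exact: surjective_pairing.
    - by move=> w; rewrite pair_nrm2E lerDr sqr_ge0.
    - by move=> w; rewrite pair_nrm2E lerDl sqr_ge0.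
  have split_pair (u v : H) : (u, v) = (u, 0) + (0, v) :> H * H.
    by apply/eqP; rewrite /eq_op /= addr0 add0r !eqxx.
  have inj1 := T_col (fun u => (u, 0)); have inj2 := T_col (fun u => (0, u)).
  rewrite {1}(split_pair (T x)) (linear_funD P_lin) inj1 ?inj2.
  - rewrite -[RHS]/((T (x, y).1, T (x, y).2)) -P_xy (split_pair x y).
    by rewrite (linear_funD P_lin) !(linear_funD T_lin).
  - by move=> k u v; apply/eqP; rewrite /eq_op /= scaler0 addr0 !eqxx.
  - by move=> a u; rewrite /L /= (linear_fun0 (repr_linear_op rpi a)).
  - by move=> u; rewrite pair_nrm2E /= nrm0 expr0n add0r.
  - by move=> k u v; apply/eqP; rewrite /eq_op /= scaler0 addr0 !eqxx.
  - by move=> a u; rewrite /L /= (linear_fun0 (repr_linear_op rpi a)).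
  - by move=> u; rewrite pair_nrm2E /= nrm0 expr0n addr0.
have [g [a _ <-]] := P_adh (T x, T y) _ (exprn_gt0 2 e0).
by rewrite T_P => /(pair_nrm_lt e0) /= ?; exists a.
Qed.

End Density.

(** * The corner cut out by a range projection *)

Section Relations.
Variables (R : realType) (A : cstarType R) (s : nat -> A).
Hypothesis sR : OAN_relations s.

Definition range_proj i : A := s i ** (s i)^star.
Definition source_proj i : A := (s i)^star ** s i.

Lemma range_proj_star i : (range_proj i)^star = range_proj i.
Proof. by rewrite cstarM cstarK. Qed.

Lemma range_proj_gen i : range_proj i ** s i = s i.
Proof. by case: sR => /(_ i). Qed.

Lemma gen_source_proj i : s i ** source_proj i = s i.
Proof. by rewrite cmulA range_proj_gen. Qed.

Lemma source_proj_sum i : source_proj i = \sum_(j < i.+1) range_proj j.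
Proof. by case: sR => _ _ /(_ i). Qed.

Lemma star_range_proj i j :
  (s i)^star ** range_proj j = if i == j then (s i)^star else 0.
Proof.
rewrite cmulA; case: eqVneq => [<-|/eqP ij]; last first.
  by case: sR => _ /(_ _ _ ij) -> _; rewrite cmul0l.
have /(congr1 (@cstar _ A)) := range_proj_gen i.
by rewrite cstarM range_proj_star cmulA.
Qed.

Lemma range_projM i j :
  range_proj i ** range_proj j = if i == j then range_proj i else 0.
Proof.
by rewrite -cmulA star_range_proj; case: eqP => // _; rewrite cmul0r.
Qed.

Lemma star_source_proj i j :
  (s i)^star ** source_proj j = if (i <= j)%N then (s i)^star else 0.
Proof.
rewrite source_proj_sum (linear_fun_sum (cmul_linearr _)).
under eq_bigr do rewrite star_range_proj.
case: leqP => ij; last first.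
  by rewrite big1 // => l _; rewrite gtn_eqF // (leq_trans (ltn_ord l)).
rewrite (bigD1 (Ordinal (ij : (i < j.+1)%N))) //= eqxx big1 ?addr0 // => l.
by rewrite -val_eqE eq_sym /= => /negPf ->.
Qed.

Lemma range_source_proj i j :
  range_proj i ** source_proj j = if (i <= j)%N then range_proj i else 0.
Proof.
by rewrite -cmulA star_source_proj; case: ifP => // _; rewrite cmul0r.
Qed.

End Relations.

Section Corner.
Variables (R : realType) (A : cstarType R) (s : nat -> A) (H : hilbertType R).
Variables (pi : A -> H -> H) (e : H -> H) (k : nat).
Hypotheses (sR : OAN_relations s) (sG : generates (range s)).
Hypotheses (rpi : representation pi) (eL : linear e) (e_cont : continuous e).
(** These hypotheses isolate what is used of the projection e = z p_k: the
    generator s_k and e commute, the corner is unitary for s_k, and e annihilates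
    the ranges of the other generators. *)
Hypothesis e_idem : forall x, e (e x) = e x.
Hypothesis e_gen0 : forall i x, i != k -> e (pi (s i) x) = 0.
Hypothesis e_gen : forall x, e (pi (s k) x) = pi (s k) (e x).
Hypothesis gen_star_e0 : forall i x, i != k -> pi ((s i)^star) (e x) = 0.
Hypothesis gen_star_e : forall x, pi ((s k)^star) (e x) = e (pi ((s k)^star) x).
Hypothesis e_range : forall x, e (pi (range_proj s k) x) = e x.
Hypothesis range_e : forall x, pi (range_proj s k) (e x) = e x.
Hypothesis source_e : forall x, pi (source_proj s k) (e x) = e x.

(** The operator e s_nu^*. *)
Fixpoint corner_word (nu : seq nat) (x : H) : H :=
  if nu is i :: nu' then corner_word nu' (pi ((s i)^star) x) else e x.

(** S commutes with e and with the unitary U = s_k e of the corner and its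
    adjoint; the elements of the corner algebra turn out to be such S. *)
Record corner_central (S : H -> H) : Prop := CornerCentral {
  cc_linear : linear S ;
  cc_cont : continuous S ;
  cc_e : forall x, S (e x) = e (S x) ;
  cc_gen : forall x, S (pi (s k) (e x)) = pi (s k) (e (S x)) ;
  cc_gen_star : forall x, S (pi ((s k)^star) (e x)) = pi ((s k)^star) (e (S x))
}.

(** Since all words nu occur, left multiplication of T by some s_i^* preserves
    this property for free; for nu empty and T = pi a o e it says that S
    commutes with e pi(a) e. *)
Definition word_commute (S T : H -> H) : Prop :=
  forall nu x, corner_word nu (T (S x)) = S (corner_word nu (T x)).

Lemma corner_word_linear nu : linear (corner_word nu).
Proof.
elim: nu => //= i nu IH a x y.
by rewrite (repr_linear_op rpi) IH.
Qed.

Lemma corner_word_bounded nu :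
  exists2 c : R, 0 <= c & forall x, nrm (corner_word nu x) <= c * nrm x.
Proof.
elim: nu => [|i nu [c c0 IH]] /=; first exact/(linear_continuousP eL).
exists (c * nrm ((s i)^star)) => [|x]; first by rewrite mulr_ge0 ?nrm_ge0.
by rewrite (le_trans (IH _)) // -mulrA ler_wpM2l // repr_contractive.
Qed.

(** A source projection to the right of s_j^* is either absorbed or kills it;
    for the empty word, e takes the place of s_j^* with j = k. *)
Lemma corner_word_source nu i x : corner_word nu (pi (source_proj s i) x) =
  if (head k nu <= i)%N then corner_word nu x else 0.
Proof.
case: nu => [|j nu] /=.
  rewrite -[in LHS]e_range -[pi (range_proj s k) _]/((pi _ \o pi _) x).
  rewrite -(reprM rpi) range_source_proj //; case: ifP => _; first exact: e_range.
  by rewrite (linear_fun0 (repr_linear rpi x)) (linear_fun0 eL).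
rewrite -[pi ((s j)^star) _]/((pi _ \o pi _) x) -(reprM rpi) star_source_proj //.
case: ifP => // _; rewrite (linear_fun0 (repr_linear rpi x)).
exact: (linear_fun0 (corner_word_linear nu)).
Qed.

(** A word beginning with s_i^* meets s_i in a source projection, which is
    absorbed or kills the word; for the empty word only i = k survives, and e s_k = U e. *)
Lemma word_commute_gen S T i : corner_central S -> word_commute S T ->
  word_commute S (pi (s i) \o T).
Proof.
move=> SC ST [|j nu] x /=; have S0 := linear_fun0 (cc_linear SC).
  have [->|ik] := eqVneq i k; last by rewrite !e_gen0.
  by rewrite !e_gen -[X in _ = S (pi _ X)]e_idem (cc_gen SC) -(ST [::]) /= e_idem.
have [->|/eqP ji] := eqVneq j i; last first.
  case: (sR) => _ /(_ _ _ ji) sji _.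
  rewrite -![pi ((s j)^star) _]/((pi ((s j)^star) \o pi (s i)) _) -(reprM rpi) sji.
  by rewrite !(linear_fun0 (repr_linear rpi _)) !(linear_fun0 (corner_word_linear nu)).
rewrite -![pi ((s i)^star) _]/((pi ((s i)^star) \o pi (s i)) _) -(reprM rpi).
by rewrite !corner_word_source; case: ifP => _; [exact: ST|].
Qed.

Lemma word_commute_star S T i : word_commute S T ->
  word_commute S (pi ((s i)^star) \o T).
Proof. by move=> ST nu x; exact: (ST (i :: nu)). Qed.

Lemma word_commute_e S : corner_central S -> word_commute S e.
Proof.
move=> SC; elim=> [|i nu IH] x /=; first by rewrite !e_idem (cc_e SC).
have [->|ik] := eqVneq i k; last first.
  rewrite !gen_star_e0 // (linear_fun0 (corner_word_linear nu)).
  by rewrite (linear_fun0 (cc_linear SC)).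
have es y : pi ((s k)^star) (e y) = e (pi ((s k)^star) (e y)).
  by rewrite -gen_star_e e_idem.
by rewrite es -(cc_gen_star SC) IH -es.
Qed.

Lemma word_commute_lin S T1 T2 c : corner_central S -> word_commute S T1 ->
  word_commute S T2 -> word_commute S (fun x => c *: T1 x + T2 x).
Proof.
by move=> SC ST1 ST2 nu x; rewrite !corner_word_linear ST1 ST2 (cc_linear SC).
Qed.

Lemma word_commute_lim S T a : corner_central S ->
  (forall d : R, 0 < d ->
     exists2 b, nrm (a - b) < d & word_commute S (pi b \o T)) ->
  word_commute S (pi a \o T).
Proof.
move=> SC H1 nu x /=; apply/eqP; rewrite -subr_eq0; apply/eqP.
have [c c0 cP] := corner_word_bounded nu.
have [c' c'0 c'P] := (linear_continuousP (cc_linear SC)).1 (cc_cont SC).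
apply: (@nrm_small _ _ _ (c * nrm (T (S x)) + c' * (c * nrm (T x)))).
move=> d d0 _; have [b bd /(_ nu x) /= bP] := H1 _ d0.
have piB y : pi a y = pi (a - b) y + pi b y.
  by rewrite (linear_funB (repr_linear rpi y)) subrK.
rewrite (piB (T (S x))) (piB (T x)) !(linear_funD (corner_word_linear nu)).
rewrite (linear_funD (cc_linear SC)) bP opprD addrACA subrr addr0.
apply: (le_trans (nrmD _ _)); rewrite nrmN mulrDl.
have le y : nrm (corner_word nu (pi (a - b) y)) <= c * nrm y * d.
  rewrite (le_trans (cP _)) // -mulrA ler_wpM2l // mulrC.
  rewrite (le_trans (repr_contractive rpi _ _)) // ler_wpM2r ?nrm_ge0 //.
  exact: ltW.
by rewrite lerD // (le_trans (c'P _)) // -mulrA ler_wpM2l.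
Qed.

(** The elements of A that preserve the property, together with their adjoints,
    form a C*-subalgebra containing the generators. *)
Lemma word_commute_repr S T a : corner_central S -> word_commute S T ->
  word_commute S (pi a \o T).
Proof.
move=> SC; pose B := [set b | forall T, word_commute S T ->
  word_commute S (pi b \o T) /\ word_commute S (pi (b^star) \o T)].
suff BT : B a by move=> /BT[].
have : smallest (@cstar_subalgebra _ A) (range s) a by rewrite (sG : _ = setT).
apply: smallest_sub; last first.
  move=> _ [i _ <-] U SU; split; first exact: word_commute_gen.
  exact: word_commute_star.
have piZD c x y : pi (c *: x + y) = (fun v => c *: pi x v + pi y v).
  by apply/funext => v; rewrite (repr_linear rpi).
split.
- split=> [U SU|c x y Bx By U SU].
    rewrite cstar0; suff: word_commute S (pi 0 \o U) by [].
    move=> nu v /=; rewrite !(linear_fun0 (repr_linear rpi _)).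
    by rewrite (linear_fun0 (corner_word_linear nu)) (linear_fun0 (cc_linear SC)).
  have [x1 x2] := Bx _ SU; have [y1 y2] := By _ SU.
  by rewrite cstarD cstarZ !piZD; split; exact: word_commute_lin.
- apply/closed_nrmP => x xB U SU; split; apply: word_commute_lim => // d /xB[b Bb bd].
    by exists b => //; case: (Bb _ SU).
  by exists (b^star); [rewrite -cstarB nrm_star|case: (Bb _ SU)].
- move=> x y Bx By U SU; rewrite cstarM.
  have piM v w : pi (v ** w) \o U = pi v \o (pi w \o U) by rewrite (reprM rpi).
  rewrite !piM.
  by split; [apply: (Bx _ _).1; case: (By _ SU)|apply: (By _ _).2; case: (Bx _ SU)].
- by move=> x Bx U SU; rewrite cstarK; case: (Bx _ SU).
Qed.

(** Empty word, T = pi a o e. *)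
Lemma corner_commute S a x : corner_central S ->
  e (pi a (e (S x))) = S (e (pi a (e x))).
Proof.
by move=> SC; apply: (word_commute_repr a SC (word_commute_e SC) [::]).
Qed.

Let gen_linear : linear (fun x => pi (s k) (e x)).
Proof. by move=> c x y; rewrite eL (repr_linear_op rpi). Qed.

Let gen_star_linear : linear (fun x => pi ((s k)^star) (e x)).
Proof. by move=> c x y; rewrite eL (repr_linear_op rpi). Qed.

Let compose_cont (f g : H -> H) : continuous f -> continuous g ->
  continuous (fun x => f (g x)).
Proof. by move=> fc gc x; apply: (continuous_comp (gc x)); exact: fc. Qed.

Let pi_cont a : continuous (pi a).
Proof. by have [] := repr_bounded rpi a. Qed.

Let gen_gen_star x : pi (s k) (e (pi ((s k)^star) (e x))) = e x.
Proof.
rewrite -gen_star_e e_idem -[LHS]/((pi _ \o pi _) _) -(reprM rpi).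
exact: range_e.
Qed.

Let gen_star_gen x : pi ((s k)^star) (e (pi (s k) (e x))) = e x.
Proof.
rewrite e_gen e_idem -[LHS]/((pi _ \o pi _) _) -(reprM rpi).
exact: source_e.
Qed.

Lemma gen_corner_central : corner_central (fun x => pi (s k) (e x)).
Proof.
split=> //; first by apply: compose_cont.
by move=> x; rewrite gen_gen_star gen_star_gen.
Qed.

Lemma gen_star_corner_central : corner_central (fun x => pi ((s k)^star) (e x)).
Proof.
split=> //; first by apply: compose_cont.
by move=> x; rewrite gen_gen_star gen_star_gen.
Qed.

(** Applying [corner_commute] to S = U and S = U^* shows that e pi(a) e is
    itself an admissible S. *)
Lemma repr_corner_central a : corner_central (fun x => e (pi a (e x))).
Proof.
have UC := corner_commute a _ gen_corner_central.
have VC := corner_commute a _ gen_star_corner_central.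
split.
- by move=> c x y; rewrite eL (repr_linear_op rpi) eL.
- by do 2!apply: compose_cont => //.
- by move=> x; rewrite !e_idem.
- by move=> x; rewrite -[in RHS]e_idem e_idem UC !e_idem.
- by move=> x; rewrite VC !e_idem.
Qed.

Lemma corner_abelian_repr a b x :
  e (pi a (e (pi b (e x)))) = e (pi b (e (pi a (e x)))).
Proof.
have := corner_commute a x (repr_corner_central b).
by rewrite !e_idem.
Qed.

End Corner.

(** * From the representation to its bicommutant *)

Section Bicommutant.
Variables (R : realType) (H : hilbertType R).
Implicit Types (M : set (H -> H)) (S T : H -> H).

Lemma sub_bicommutant M : M `<=` @bounded_operators R H ->
  M `<=` commutant (commutant M).
Proof.
by move=> Mb T MT; split; [exact: Mb|move=> U [_ UM]; rewrite UM].
Qed.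

Lemma commutant_compose M S T : commutant M S -> commutant M T ->
  commutant M (S \o T).
Proof.
move=> [[SL Sc] SM] [[TL Tc] TM]; split; last first.
  by move=> U MU; rewrite -compA TM // compA SM // compA.
by split; [exact: linear_compose|move=> x; exact: (continuous_comp (Tc x) (Sc _))].
Qed.

End Bicommutant.

Section CornerOfBicommutant.
Variables (R : realType) (A : cstarType R) (H : hilbertType R).
Variables (pi : A -> H -> H) (e : H -> H) (p : A).
Hypotheses (rpi : representation pi) (eL : linear e) (e_cont : continuous e).
Hypothesis e_idem : forall x, e (e x) = e x.
Hypothesis p_e : forall x, pi p (e x) = e x.

Let M := commutant (commutant (range pi)).

(** Approximate T by one and the same pi(a) at the two vectors e x and e (S x). *)
Lemma corner_commute_bicommutant S T x : linear S -> continuous S ->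
  (forall x, S (e x) = e (S x)) ->
  (forall a x, S (e (pi a (e x))) = e (pi a (e (S x)))) ->
  M T -> S (e (T (e x))) = e (T (e (S x))).
Proof.
move=> SL Sc Se Sa MT; apply/eqP; rewrite -subr_eq0; apply/eqP.
have [c c0 cP] := (linear_continuousP SL).1 Sc.
have [b b0 bP] := (linear_continuousP eL).1 e_cont.
apply: (@nrm_small _ _ _ (c * b + b)) => d d0 _.
have [a [a1 a2]] := bicommutant_approx rpi MT (p_e x) (p_e (S x)) d0.
have -> : S (e (T (e x))) - e (T (e (S x))) =
    S (e (T (e x) - pi a (e x))) - e (T (e (S x)) - pi a (e (S x))).
  by rewrite !(linear_funB eL) (linear_funB SL) Sa opprB addrA subrK.
apply: (le_trans (nrmD _ _)); rewrite nrmN mulrDl lerD //.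
  rewrite (le_trans (cP _)) // -mulrA ler_wpM2l // (le_trans (bP _)) //.
  by rewrite ler_wpM2l // ltW.
by rewrite (le_trans (bP _)) // ler_wpM2l // ltW.
Qed.

(** The commutation lemma is applied twice: first to bring S from pi(A) to the
    bicommutant, then T. *)
Lemma corner_abelian_bicommutant S T :
  (forall a b x, e (pi a (e (pi b (e x)))) = e (pi b (e (pi a (e x))))) ->
  M S -> M T -> (e \o S \o e) \o (e \o T \o e) = (e \o T \o e) \o (e \o S \o e).
Proof.
move=> ab MS MT; apply/funext => x /=; rewrite !e_idem.
have corner_op U : @bounded_operators R H U ->
    linear (fun y => e (U (e y))) /\ continuous (fun y => e (U (e y))).
  move=> [UL Uc]; split=> [c y w|y]; first by rewrite eL UL eL.
  apply: (@continuous_comp _ _ _ (fun y => U (e y)) e); last exact: e_cont.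
  by apply: continuous_comp; [exact: e_cont|exact: Uc].
have [SL Sc] := corner_op S MS.1.
have Se U y : e (U (e (e y))) = e (e (U (e y))) by rewrite !e_idem.
have Sa a y : e (S (e (e (pi a (e y))))) = e (pi a (e (e (S (e y))))).
  have [aL ac] := corner_op (pi a) (repr_bounded rpi a).
  have := corner_commute_bicommutant y aL ac (Se _) _ MS.
  by rewrite !e_idem => -> // b w; rewrite !e_idem.
by have := corner_commute_bicommutant x SL Sc (Se _) Sa MT; rewrite !e_idem.
Qed.

End CornerOfBicommutant.

(** The elements a with z pi(a) = 0 form a C*-subalgebra, which contains
    s_k = p_k s_k for every k. *)
Lemma nondegenerate_generators (R : realType) (A : cstarType R) (s : nat -> A)
    (H : hilbertType R) (pi : A -> H -> H) (z : H -> H) :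
  OAN_relations s -> generates (range s) -> representation pi ->
  nondegenerate_rep pi -> orthogonal_projection z ->
  (forall a x, z (pi a x) = pi a (z x)) ->
  (forall k x, z (pi (range_proj s k) x) = 0) -> z = cst 0.
Proof.
move=> sR sG rpi pi_nd [[zL zc] _ z_sym] z_pi z0.
have [c c0 cP] := (linear_continuousP zL).1 zc.
pose B := [set a | forall x, z (pi a x) = 0].
have BT a : B a.
  have : smallest (@cstar_subalgebra _ A) (range s) a by rewrite (sG : _ = setT).
  apply: smallest_sub; last first.
    move=> _ [i _ <-] x; rewrite -(range_proj_gen sR) (reprM rpi).
    exact: z0.
  split.
  - split=> [x|r a1 a2 B1 B2 x].
      by rewrite (linear_fun0 (repr_linear rpi x)) (linear_fun0 zL).
    by rewrite (repr_linear rpi) zL B1 B2 scaler0 addr0.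
  - apply/closed_nrmP => a1 H1 x; apply: (@nrm_small _ _ _ (c * nrm x)).
    move=> d d0 _; have [b Bb bd] := H1 _ d0.
    rewrite -[a1](subrK b) (linear_funD (repr_linear rpi x)) (linear_funD zL).
    rewrite Bb addr0 (le_trans (cP _)) // -mulrA ler_wpM2l //.
    rewrite (le_trans (repr_contractive rpi _ _)) // mulrC.
    by rewrite ler_wpM2l ?nrm_ge0 // ltW.
  - by move=> a1 a2 B1 _ x; rewrite (reprM rpi) /= B1.
  - move=> a1 B1 x; apply: dot_eq0 => y.
    by rewrite z_sym (repr_star rpi) cstarK -z_pi B1 linear0r.
apply/funext => y; pose K := [set x | z x = 0].
suff : K y by []; have : [set: H] y by [].
rewrite -pi_nd; apply: smallest_sub; last by move=> _ [a [x ->]]; exact: BT.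
split.
  split=> [|r u v u0 v0]; first exact: linear_fun0.
  by rewrite /K /= zL u0 v0 scaler0 addr0.
apply/closed_nrmP => x xB; apply: (@nrm_small _ _ _ c) => d d0 _.
have [w w0 wd] := xB _ d0.
rewrite -[x](subrK w) (linear_funD zL) w0 addr0 (le_trans (cP _)) //.
by rewrite ler_wpM2l // ltW.
Qed.

Theorem corollary3p13 (R : realType) (A : cstarType R) (s : nat -> A)
  (hA : universal_cstar (@OAN_relations R) s) : type_I_cstar A.
Proof.
case: hA => sR sG _ H pi rpi pi_nd.
have pi_M a : commutant (commutant (range pi)) (pi a).
  by apply: sub_bicommutant; [move=> _ [b _ <-]; exact: (repr_bounded rpi)|exists a].
move=> z [Mz [[zL zc] zz z_sym] [_ z_comm]] z_neq0.
have z_idem x : z (z x) = z x by exact: (congr1 (@^~ x) zz).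
have z_pi a x : z (pi a x) = pi a (z x).
  exact: (congr1 (@^~ x) (z_comm _ (pi_M a))).
(* k is chosen minimal, so that z kills p_j for all j < k. *)
have ex_k : exists k, `[< exists x, z (pi (range_proj s k) x) <> 0 >].
  apply: contrapT => no_k; apply: z_neq0.
  apply: (nondegenerate_generators sR sG rpi pi_nd) => // k x.
  by apply: contrapT => zkx; apply: no_k; exists k; apply/asboolP; exists x.
have [k /asboolP[x0 zx0] k_min] := ex_minnP ex_k.
have z_lt j x : (j < k)%N -> z (pi (range_proj s j) x) = 0.
  move=> jk; apply: contrapT => zj; move: jk; rewrite ltnNge => /negP; apply.
  by apply: k_min; apply/asboolP; exists x.
have piM a b x : pi a (pi b x) = pi (a ** b) x by rewrite (reprM rpi).
have pi0 x : pi 0 x = 0 := linear_fun0 (repr_linear rpi x).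
have z0 := linear_fun0 zL.
pose e x := z (pi (range_proj s k) x).
have e_source x : z (pi (source_proj s k) x) = e x.
  rewrite (source_proj_sum sR) (linear_fun_sum (repr_linear rpi x)).
  rewrite (linear_fun_sum zL) big_ord_recr /= big1 ?add0r // => j _.
  exact: z_lt.
have e_range x : e (pi (range_proj s k) x) = e x.
  by rewrite /e piM (range_projM sR) eqxx.
have range_e x : pi (range_proj s k) (e x) = e x by rewrite -z_pi; exact: e_range.
have e_idem x : e (e x) = e x by rewrite {1}/e range_e; exact: z_idem.
have Me : commutant (commutant (range pi)) e.
  exact: commutant_compose Mz (pi_M _).
have [[eL ec] _] := Me.
have e_gen0 i x : i != k -> e (pi (s i) x) = 0.
  move=> ik; rewrite /e -[s i](range_proj_gen sR) -piM piM (range_projM sR).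
  by rewrite eq_sym (negPf ik) pi0.
have e_gen x : e (pi (s k) x) = pi (s k) (e x).
  by rewrite -[e x]e_source -z_pi piM gen_source_proj // /e piM range_proj_gen.
have gen_star_e0 i x : i != k -> pi ((s i)^star) (e x) = 0.
  by move=> ik; rewrite -z_pi piM (star_range_proj sR) (negPf ik) pi0.
have gen_star_e x : pi ((s k)^star) (e x) = e (pi ((s k)^star) x).
  by rewrite -[RHS]e_source /e -z_pi !piM -cmulA (star_range_proj sR) eqxx.
have source_e x : pi (source_proj s k) (e x) = e x.
  by rewrite -z_pi e_source e_range.
exists e; split; last 2 first.
- by move=> e0; apply: zx0; exact: (congr1 (@^~ x0) e0).
- by apply/funext => x /=; rewrite z_idem.
split=> //.
  split=> //; first by apply/funext.
  by move=> x y; rewrite z_sym (repr_star rpi) range_proj_star -z_pi.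
move=> S T MS MT.
apply: (corner_abelian_bicommutant rpi eL ec e_idem range_e) MS MT => a b x.
exact: (corner_abelian_repr sR sG rpi eL ec e_idem e_gen0 e_gen gen_star_e0).
Qed.
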